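(* For all integers $n,m,k\geq 0$ and any indeterminate $\lambda$, \begin{align*} L_{n+k,k} &= \sum_{j=0}^{n}(-1)^{n-j}\binom{n}{j}(k+j+1)^{k+j-1},\\ L_{n+m+k,m+k}&= \sum_{j=0}^{m}\binom{m}{j}L_{n+k+j,k},\\ \sum_{j=0}^{n}\binom{j+\lambda-1}{j}L_{n+m,m+j} &= \sum_{j=0}^{n}(-1)^{n-j}\binom{n+\lambda}{j}(m+j+1)^{m+j-1}. \end{align*}
   Context: A labeled forest on a finite set $S$ is a set of rooted trees whose vertex sets partition $S$; a singleton tree is a tree with exactly one vertex. For $0\le k\le n$, $L_{n,k}$ is the number of labeled forests on $[n+1]=\{1,\dots,n+1\}$ in which $\{k+1\}$ is a singleton tree and no $i>k+1$ forms a singleton tree. Binomial coefficients in $\lambda$ are polynomials in $\lambda$; $(1)^{-1}=1$. *)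

(* Defs.v *)
From mathcomp Require Import all_boot all_order all_algebra.

Set Implicit Arguments.
Unset Strict Implicit.
Unset Printing Implicit Defensive.

Import GRing.Theory.
Local Open Scope ring_scope.

Section RootedTrees.

Variable T : finType.

(* The components are the vertex set, the edge set (edges are unordered pairs
   of vertices) and the root. *)
Definition rooted_graph : Type := ({set T} * {set {set T}} * T)%type.

Implicit Types (t : rooted_graph) (F : {set rooted_graph}).

Definition vertices t : {set T} := t.1.1.
Definition edges t : {set {set T}} := t.1.2.
Definition root_of t : T := t.2.

Definition adj t : rel T := [rel x y | [set x; y] \in edges t].

Definition simple_graph t : bool :=
  [forall e in edges t, (#|e| == 2) && (e \subset vertices t)].

Definition connected_graph t : bool :=
  [forall x in vertices t, forall y in vertices t, connect (adj t) x y].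

(* A simple cycle has at least 3 and, having no repetition, at most #|T|
   vertices. *)
Definition acyclic_graph t : bool :=
  [forall l : 'I_#|T|.+1, forall c : l.-tuple T,
     (2 < l)%N ==> ~~ ucycleb (adj t) c].

Definition rooted_tree t : bool :=
  [&& root_of t \in vertices t, simple_graph t,
      connected_graph t & acyclic_graph t].

(* [vertices] has to be injective on F: otherwise two trees of F could have
   the same vertex set, and the image would still be a partition. *)
Definition labeled_forest F : bool :=
  [&& [forall t in F, rooted_tree t],
      dinjectiveb vertices (mem F)
    & partition (vertices @: F) [set: T]].

Definition singleton_tree F (x : T) : bool :=
  [exists t in F, vertices t == [set x]].

End RootedTrees.

(* The element i of [n+1] = {1, ..., n+1} is the ordinal of value i - 1 in
   'I_n.+1, so that the label k+1 is the ordinal of value k.  The number is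
   only meaningful for k <= n; it is 0 otherwise. *)
Definition L (n k : nat) : nat :=
  #|[set F : {set rooted_graph 'I_n.+1} |
      labeled_forest F &&
      [exists v : 'I_n.+1,
         [&& v == k :> nat, singleton_tree F v
           & [forall i : 'I_n.+1, (v < i)%N ==> ~~ singleton_tree F i]]]]|.

(* The binomial coefficient "p choose j" as a polynomial:
   p (p - 1) ... (p - j + 1) / j!. *)
Definition binom_poly (p : {poly rat}) (j : nat) : {poly rat} :=
  (j`!%:R)^-1 *: \prod_(i < j) (p - i%:R).

(* (a+1)^(a-1), with an integer exponent: it is 1 ^ (-1) = 1 for a = 0. *)
Definition cayley_power (a : nat) : rat := (a.+1)%:R ^ (a%:Z - 1).

(* Main.v *)
Require Import Defs.
From mathcomp Require Import all_boot all_order all_algebra.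
From mathcomp Require Import ring.

Set Implicit Arguments.
Unset Strict Implicit.
Unset Printing Implicit Defensive.

Import GRing.Theory Num.Theory.

(** A labeled forest on [T] is encoded by its parent function [p : T -> T], whose
    fixed points are the roots and whose only cycles are these fixed points.
    Counting the parent functions from a set of a vertices to r given roots by
    their first layer S (the vertices whose parent is a root) gives
    N(a, r) = sum_s C(a, s) r^s N(a - s, s), hence N(a, r) = r (a + r)^(a - 1), and
    the number of rooted forests on a vertices is f(a) = (a + 1)^(a - 1).
    Requiring one more vertex not to be a singleton tree subtracts the forests on
    the remaining vertices, so L(n + k, k) is the n-th forward difference of f at
    k.  The three identities then hold for the differences of any sequence, by
    induction on the number of differences. *)

(** * Parent functions *)

(** On a finite type this excludes exactly the cycles of length at least 2. *)
Definition grounded (T : finType) (p : {ffun T -> T}) : bool :=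
  [forall x, exists r, (p r == r) && fconnect p x r].

Lemma fconnect_fix (T : finType) (p : T -> T) r x :
  p r = r -> fconnect p r x -> x = r.
Proof. by move=> pr /iter_findex <-; apply: iter_fix. Qed.

Lemma fconnect_fix_next (T : finType) (p : T -> T) r x :
  p r = r -> fconnect p (p x) r = fconnect p x r.
Proof.
move=> pr; apply/idP/idP => [|/iter_findex].
  exact: connect_trans (fconnect1 p x).
case: (findex _ _ _) => [/= ->|n]; first by rewrite pr.
by rewrite iterSr => <-; apply: fconnect_iter.
Qed.

(** This makes the root of a vertex unique. The induction is on the number of steps to [r']: one
    step keeps the fixed point [r] reachable. *)
Lemma fconnect_fix_inj (T : finType) (p : T -> T) r r' x :
  p r = r -> p r' = r' -> fconnect p x r -> fconnect p x r' -> r = r'.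
Proof.
move=> pr pr' + /iter_findex xr'; move: (findex _ _ _) xr' => n <- {r'} in pr' *.
elim: n => [|n IHn] in x pr' * => //= xr; first by rewrite (fconnect_fix pr' xr).
by rewrite -iterS iterSr; apply: IHn; rewrite -?iterSr ?fconnect_fix_next.
Qed.

(** A decreasing rank is a local condition, easier to carry through gluing than reachability. The
    rank chosen for [x] is the number of vertices reachable from it. *)
Lemma groundedP (T : finType) (p : {ffun T -> T}) :
  reflect (exists d : T -> nat, forall x, p x != x -> (d (p x) < d x)%N)
          (grounded p).
Proof.
apply: (iffP forallP) => [gp | [d dp] x].
  exists (fun x => #|[set y | fconnect p x y]|) => x px.
  apply/proper_card/properP; split.
    by apply/subsetP => y; rewrite !inE; apply/connect_trans/fconnect1.
  exists x; rewrite !inE ?connect0 //; apply/negP => pxx.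
  have /existsP[r /andP[/eqP pr xr]] := gp x.
  (* A return from [p x] to [x] makes [x] periodic; a multiple of the period at least as large as
     the distance to [r] then gives [x = r]. *)
  have cyc k : iter (k * (findex p (p x) x).+1) p x = x.
    by elim: k => // k IHk; rewrite mulSn iterD IHk iterSr iter_findex.
  suff exr : x = r by rewrite exr pr eqxx in px.
  by rewrite -[LHS](cyc (findex p x r)) mulnS addnC iterD iter_findex // iter_fix.
have [n] := ubnP (d x); elim: n x => // n IHn x dx.
have [px|px] := eqVneq (p x) x; first by apply/existsP; exists x; rewrite px eqxx connect0.
have /existsP[r /andP[pr xr]] := IHn (p x) (leq_trans (dp x px) dx).
by apply/existsP; exists r; rewrite pr (connect_trans (fconnect1 p x)).
Qed.

(** * Splitting a forest at its first layer *)

Section Layers.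
Variable T : finType.
Implicit Types (A R S B : {set T}) (p q : {ffun T -> T}).

(** Fixing every vertex outside [A] makes the function on [T] determined by its values on [A]. For
    disjoint [A] and [R] these are the forests on their union with root set [R]. *)
Definition rooted_at A R : {set {ffun T -> T}} :=
  [set p | grounded p &
   [forall x, if x \in A then (p x \in A :|: R) && (p x != x) else p x == x]].

Lemma rooted_atP A R p :
  reflect [/\ grounded p, {in A, forall x, p x \in A :|: R},
    {in A, forall x, p x != x} & forall x, x \notin A -> p x = x]
    (p \in rooted_at A R).
Proof.
rewrite inE; apply: (iffP andP) => [[gp /forallP h]|[gp hA hn hf]].
  split=> // x xA; have := h x; first by rewrite xA => /andP[].
    by rewrite xA => /andP[].
  by rewrite (negPf xA) => /eqP.
by split=> //; apply/forallP => x; case: ifPn => xA; rewrite ?hA ?hn ?hf ?eqxx.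
Qed.

Lemma rooted_at0 R : rooted_at set0 R = [set [ffun x => x]].
Proof.
apply/setP => p; rewrite in_set1; apply/rooted_atP/eqP => [[_ _ _ h]|->].
  by apply/ffunP => x; rewrite ffunE h ?inE.
split=> [|x|x|x]; rewrite ?inE ?ffunE //; apply/groundedP.
by exists (fun=> 0) => x; rewrite ffunE eqxx.
Qed.

(** Without roots [p] maps [A] into itself while the rank drops at each step, an infinite
    descent. *)
Lemma rooted_at_set0 A : A != set0 -> rooted_at A set0 = set0.
Proof.
case/set0Pn=> a aA; apply/eqP/set0Pn => -[p /rooted_atP[/groundedP[d dp] hA hn _]].
have [n] := ubnP (d a); elim: n a aA => // n IHn a aA da.
apply: (IHn (p a)); first by have := hA a aA; rewrite setU0.
exact: leq_trans (dp a (hn a aA)) da.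
Qed.

Definition first_layer R p A := [set x in A | p x \in R].

(** Each vertex of [S] chooses its root in [R] freely, and the rest is a forest on [A :\: S] with
    root set [S]; [glue] joins the two parts. *)
Lemma card_layer A R S : [disjoint A & R] -> S \subset A ->
  #|[set p in rooted_at A R | first_layer R p A == S]| =
  #|R| ^ #|S| * #|rooted_at (A :\: S) S|.
Proof.
(* Off [S] the choice function is forced to be the identity and contributes a factor 1. *)
move=> dAR sSA; pose fam x : pred T := if x \in S then [in R] else pred1 x.
have -> : #|R| ^ #|S| = #|[set g : {ffun T -> T} | g \in family fam]|.
  rewrite cardsE card_family foldrE big_map big_enum /= (bigID [in S]) /=.
  rewrite [X in (_ * X)%N]big1 ?muln1.
    under eq_bigr => x xS do rewrite /fam xS.
    by rewrite prod_nat_const.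
  by move=> x xS; rewrite /fam (negPf xS) card1.
rewrite -cardsX; pose glue (gq : {ffun T -> T} * {ffun T -> T}) : {ffun T -> T} :=
  [ffun x => if x \in S then gq.1 x else gq.2 x].
rewrite -(card_in_imset (f := glue)).
  apply: eq_card => p; rewrite inE; apply/andP/imsetP.
    case=> /rooted_atP[gp hA hn hf] /eqP eS.
    have inS x : (x \in S) = (x \in A) && (p x \in R) by rewrite -eS inE.
    exists ([ffun x => if x \in S then p x else x], [ffun x => if x \in S then x else p x]).
      rewrite inE /= inE; apply/andP; split.
        apply/familyP => x; rewrite /fam ffunE; case: ifPn => xS; last exact: eqxx.
        by move: xS; rewrite inS => /andP[].
      apply/rooted_atP; split.
      - case/groundedP: gp => d dp; apply/groundedP; exists d => x.
        by rewrite ffunE; case: ifP => [|_ /dp]; rewrite ?eqxx.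
      - move=> x; rewrite !inE ffunE => /andP[/[dup] xS /negPf -> xA].
        have := hA x xA; rewrite inE; move: xS; rewrite inS xA /= => /negPf->.
        by rewrite orbF => ->; rewrite andbT orNb.
      - by move=> x; rewrite !inE ffunE => /andP[/negPf -> xA]; apply: hn.
      - move=> x; rewrite !inE ffunE; case: ifP => //= _; exact: hf.
    by apply/ffunP => x; rewrite !ffunE /= ?ffunE; case: (x \in S).
  case=> [[g q]] /setXP[]; rewrite inE => /familyP gfam /rooted_atP[gq hA hn hf] ->.
  have gS x : x \in S -> g x \in R by move=> xS; have := gfam x; rewrite /fam xS.
  have RA x : x \in R -> x \in A = false.
    by move=> xR; apply/negP => xA; have/pred0P/(_ x) := dAR; rewrite /= xA xR.
  have qA x : x \in A -> x \notin S -> q x \in A.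
    move=> xA xS; have := hA x; rewrite !inE xS xA => /(_ isT) /orP[/andP[]//|].
    exact: (subsetP sSA).
  split.
    apply/rooted_atP; split.
    - case/groundedP: gq => d dq; apply/groundedP.
      (* The rank of [q] is raised by one on [A] and set to 0 elsewhere, so that it also drops from
         [S] to [R]. *)
      exists (fun x => if x \in A then (d x).+1 else 0) => x; rewrite ffunE /=.
      have [xA|xA] := boolP (x \in A); case: ifPn => xS.
      + by rewrite RA // gS.
      + by rewrite qA // ltnS; apply: dq.
      + by rewrite (subsetP sSA) in xA.
      + by rewrite hf ?eqxx // !inE (negPf xA) andbF.
    - move=> x xA; rewrite !inE ffunE /=; case: ifPn => xS; first by rewrite gS ?orbT.
      by rewrite qA.
    - move=> x xA; rewrite ffunE /=; case: ifPn => xS; last by rewrite hn // !inE xS.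
      by apply: contraL xA => /eqP <-; rewrite RA ?gS.
    - move=> x xA; rewrite ffunE /=; case: ifPn => xS; first by rewrite (subsetP sSA) in xA.
      by rewrite hf // !inE (negPf xA) andbF.
  apply/eqP/setP => x; rewrite !inE ffunE /=; case: ifPn => xS.
    by rewrite (subsetP sSA) ?gS.
  apply/andP => -[xA]; have := qA x xA xS => /[swap] /RA ->; by [].
(* Injectivity of [glue]: the discarded values, of [g] off [S] and of [q] on [S], are those of the
   identity. *)
move=> [g q] [g' q'] /setXP[/= + /rooted_atP[_ _ _ hf]] /setXP[/= + /rooted_atP[_ _ _ hf']].
rewrite !inE => /familyP gfam /familyP gfam' /ffunP e.
congr pair; apply/ffunP => x; have := e x; rewrite !ffunE /=.
- have := gfam x; have := gfam' x; rewrite /fam.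
  by case: ifP => // _ /eqP -> /eqP ->.
- by case: ifPn => // xS _; rewrite hf ?hf' // !inE xS.
Qed.

Lemma card_rooted_at_rec A R : [disjoint A & R] ->
  #|rooted_at A R| =
  \sum_(S : {set T} | S \subset A) #|R| ^ #|S| * #|rooted_at (A :\: S) S|.
Proof.
move=> dAR; rewrite -sum1_card.
rewrite (partition_big (fun p => first_layer R p A) (fun S => S \subset A)) /=; last first.
  by move=> p _; apply/subsetP => x; rewrite inE => /andP[].
by apply: eq_bigr => S sSA; rewrite -card_layer // sum1dep_card; apply: eq_card => p; rewrite !inE.
Qed.

End Layers.
(** This is r (a + r)^(a - 1), the number of forests on a + r vertices with r prescribed roots; a =
    0 is set apart because its exponent would be negative. *)
Definition planted_count (a r : nat) := if a is a'.+1 then r * (a + r) ^ a' else 1.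

(** The term s = 0 vanishes. In the others s C(a+1, s) = (a+1) C(a, s-1) absorbs the factor s and
    leaves r times the binomial expansion of (a + 1 + r)^a. *)
Lemma planted_count_rec a r :
  \sum_(s < a.+2) 'C(a.+1, s) * (r ^ s * planted_count (a.+1 - s) s) =
  planted_count a.+1 r.
Proof.
rewrite big_ord_recl /= mul0n !muln0 add0n expnDn big_distrr /=.
apply: eq_bigr => i _; rewrite /bump add1n subSS expnS.
have e : 'C(a.+1, i.+1) * planted_count (a - i) i.+1 = 'C(a, i) * a.+1 ^ (a - i).
  (* At i = a [planted_count] takes its separate value 1. *)
  have := ltn_ord i; rewrite ltnS leq_eqVlt => /predU1P[->|ia].
    by rewrite subnn !binn.
  have -> : planted_count (a - i) i.+1 = i.+1 * a.+1 ^ (a - i).-1.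
    case E: (a - i) => [|c] /=; first by move: ia; rewrite -subn_gt0 E.
    by rewrite -E addnS subnK // ltnW.
  by rewrite mulnA [_ * i.+1]mulnC -mul_bin_diag mulnC mulnA -expnSr prednK ?subn_gt0 // mulnC.
by rewrite mulnCA e -mulnA; congr (_ * _); rewrite mulnCA [r ^ i * _]mulnC.
Qed.

Lemma sum_subsets_card (T : finType) (A : {set T}) (g : nat -> nat) :
  \sum_(S : {set T} | S \subset A) g #|S| = \sum_(s < #|A|.+1) 'C(#|A|, s) * g s.
Proof.
rewrite (partition_big (fun S : {set T} => inord #|S| : 'I_#|A|.+1) xpredT) //=.
apply: eq_bigr => s _; rewrite -cards_draws -sum1dep_card big_distrl /=.
apply: eq_big => [S|S /andP[sSA /eqP <-]].
  have [sSA|] := boolP (S \subset A) => //=.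
  by rewrite -val_eqE /= inordK // ltnS subset_leq_card.
by rewrite mul1n inordK // ltnS subset_leq_card.
Qed.

(** * Finite differences *)

Section FiniteDifferences.
Local Open Scope ring_scope.

Fixpoint fdiff (V : zmodType) (n : nat) (f : nat -> V) (k : nat) : V :=
  if n is n'.+1 then fdiff n' f k.+1 - fdiff n' f k else f k.

Arguments fdiff : simpl never.

Lemma fdiffS (V : zmodType) (f : nat -> V) n k :
  fdiff n.+1 f k = fdiff n f k.+1 - fdiff n f k.
Proof. by []. Qed.

(** Used with [polyC], to carry differences of rationals to constant polynomials. *)
Lemma raddf_fdiff (U V : zmodType) (h : {additive U -> V}) (f : nat -> U) n k :
  h (fdiff n f k) = fdiff n (h \o f) k.
Proof. by elim: n k => // n IHn k; rewrite !fdiffS raddfB !IHn. Qed.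

(** Taking one difference on the sequence first allows inductions on [n] in which [f] varies. *)
Lemma fdiffSr (V : zmodType) (f : nat -> V) n k :
  fdiff n.+1 f k = fdiff n (fun a => f a.+1 - f a) k.
Proof.
by elim: n k => // n IHn k; rewrite fdiffS !IHn.
Qed.

(** The shift is the identity plus the difference operator; its m-th power expands binomially. *)
Lemma fdiff_shift (R : pzRingType) (f : nat -> R) n m k :
  fdiff n f (m + k) = \sum_(j < m.+1) 'C(m, j)%:R * fdiff (n + j) f k.
Proof.
elim: m n => [|m IHm] n; first by rewrite big_ord1 bin0 mul1r addn0.
have -> : fdiff n f (m.+1 + k) = fdiff n f (m + k) + fdiff n.+1 f (m + k).
  by rewrite fdiffS addrC subrK.
rewrite !IHm [in RHS]big_ord_recl /= bin0 mul1r addn0.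
rewrite big_ord_recl /= bin0 mul1r addn0 -addrA; congr (_ + _).
under [in RHS]eq_bigr => i _ do rewrite /bump add1n binS natrD mulrDl addnS -addSn.
rewrite [in RHS]big_split /=. congr (_ + _).
by rewrite [RHS]big_ord_recr /= bin_small // mul0r addr0; apply: eq_bigr => i _;
  rewrite addSn -addnS.
Qed.

Lemma binom_poly0 (p : {poly rat}) : binom_poly p 0 = 1.
Proof. by rewrite /binom_poly big_ord0 invr1 scale1r. Qed.

Lemma binom_polyS (p : {poly rat}) j :
  binom_poly p j.+1 *+ j.+1 = (p - j%:R) * binom_poly p j.
Proof.
rewrite /binom_poly big_ord_recr /= factS natrM invfM -scaler_nat scalerA mulrA.
rewrite divff ?pnatr_eq0 // mul1r.
by rewrite mulrC -scalerAr.
Qed.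

(** Both sides are compared through [binom_polyS] after multiplication by a positive integer, which
    is injective on rational polynomials. *)
Lemma binom_poly_pascal (p : {poly rat}) j :
  binom_poly (1 + p) j.+1 = binom_poly p j.+1 + binom_poly p j.
Proof.
have inj n : injective (fun q : {poly rat} => q *+ n.+1).
  by move=> q q' /eqP; rewrite -subr_eq0 -mulrnBl -mulr_natr mulf_eq0
    -polyC_natr polyC_eq0 pnatr_eq0 orbF subr_eq0 => /eqP.
elim: j => [|j IHj].
  by apply: (inj 0) => /=; rewrite binom_polyS mulrnDl binom_polyS !binom_poly0; ring.
apply: (inj j.+1) => /=; rewrite binom_polyS IHj mulrnDl binom_polyS.
have := binom_polyS p j.
move: (binom_poly p j) (binom_poly p j.+1) => a b e.
rewrite mulrDr -!natr1 -[b *+ j.+2]mulr_natr.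
have -> : (1 + p - (j%:R + 1)) * a = b *+ j.+1 by rewrite e; ring.
by rewrite -[b *+ j.+1]mulr_natr -!natr1; ring.
Qed.

(** Induction on [n], applied to the first difference of [f]. On the right, Pascal's rule yields the
    same two sums, one of them shifted by an index. *)
Lemma binom_poly_diff (f : nat -> {poly rat}) (p : {poly rat}) n m :
  \sum_(j < n.+1) binom_poly (j%:R + p - 1) j * fdiff (n - j) f (m + j) =
  \sum_(j < n.+1) (-1) ^+ (n - j) * binom_poly (n%:R + p) j * f (m + j)%N.
Proof.
elim: n f => [|n IHn] f; first by rewrite !big_ord1 /= !binom_poly0 !mul1r.
rewrite big_ord_recr /= subnn.
under eq_bigr => j _ do rewrite subSn ?fdiffSr -1?ltnS //.
rewrite IHn; under [in LHS]eq_bigr => j _ do rewrite mulrBr.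
rewrite sumrB addrAC [in RHS]big_ord_recl /= [X in _ - X]big_ord_recl.
rewrite opprD !addnS !subn0 !binom_poly0 !mulr1 addrCA exprS mulN1r mulNr.
congr (_ + _).
under [in RHS]eq_bigr => i _.
  rewrite /bump add1n subSS -nat1r -addrA binom_poly_pascal mulrDr mulrDl.
  over.
rewrite big_split /= [X in _ = X + _]big_ord_recr /=.
rewrite subnn mul1r -addrA addrC; congr (_ + _); last first.
  by apply: eq_bigr => i _; rewrite addnS.
rewrite addrC -sumrN; congr (_ + _).
  apply: eq_bigr => i _; rewrite /bump add1n -[in RHS](subnSK (ltn_ord i)).
  by rewrite exprS mulN1r !mulNr.
(* The term j = n + 1 split off on the left supplies the last term from Pascal's rule, as (n + 1) +
   p - 1 = n + p. *)
by rewrite -natr1 addrAC addrK addnS.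
Qed.

(** The n-th power of the shift minus the identity, expanded by the same induction with the usual
    Pascal rule. *)
Lemma fdiffE (R : pzRingType) (f : nat -> R) n k :
  fdiff n f k = \sum_(j < n.+1) (-1) ^+ (n - j) * 'C(n, j)%:R * f (k + j)%N.
Proof.
elim: n f => [|n IHn] f; first by rewrite big_ord1 bin0 !mul1r addn0.
rewrite fdiffSr IHn; under [in LHS]eq_bigr => j _ do rewrite mulrBr.
rewrite sumrB [in RHS]big_ord_recl /= [X in _ - X]big_ord_recl.
rewrite opprD !subn0 !bin0 !mulr1 addrCA exprS mulN1r mulNr; congr (_ + _).
under [in RHS]eq_bigr => i _ do
  rewrite /bump add1n subSS binS natrD mulrDr mulrDl.
rewrite big_split /= [X in _ = X + _]big_ord_recr /= bin_small // mulr0 mul0r addr0.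
rewrite addrC -sumrN; congr (_ + _).
  apply: eq_bigr => i _; rewrite /bump add1n -[in RHS](subnSK (ltn_ord i)).
  by rewrite exprS mulN1r !mulNr.
by apply: eq_bigr => i _; rewrite addnS.
Qed.

End FiniteDifferences.

(** * Counting forests with prescribed non-singleton vertices *)

Section Count.
Variable T : finType.
Implicit Types (A R S B I : {set T}) (p q : {ffun T -> T}).

Lemma card_rooted_at A R : [disjoint A & R] ->
  #|rooted_at A R| = planted_count #|A| #|R|.
Proof.
have [n] := ubnP #|A|; elim: n A R => // n IHn A R An dAR.
have [->|[a aA]] := set_0Vmem A; first by rewrite rooted_at0 cards0 cards1.
have A0 : A != set0 by apply/set0Pn; exists a.
rewrite card_rooted_at_rec //.
under eq_bigr => S sSA.
  have -> : #|rooted_at (A :\: S) S| = planted_count (#|A| - #|S|) #|S|.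
    have dS : [disjoint A :\: S & S] by rewrite -setI_eq0 setIDAC setDIl setDv setI0.
    rewrite -[in X in planted_count X](setIidPr sSA) -cardsD.
    have [->|S0] := eqVneq S set0.
      by rewrite setD0 rooted_at_set0 // !cards0; move: A0; rewrite -card_gt0; case: #|A|.
    apply: IHn => //; rewrite cardsD (setIidPr sSA).
    rewrite -ltnS; apply: leq_trans An; rewrite ltnS ltn_subrL card_gt0 S0.
    by rewrite card_gt0.
  over.
rewrite (sum_subsets_card A (fun s => #|R| ^ s * planted_count (#|A| - s) s)).
have: 0 < #|A| by rewrite card_gt0.
by case: #|A| => // b _; apply: planted_count_rec.
Qed.

(** The instance y = x makes [x] a root; the others say that it has no child. *)
Definition isolated p x := [forall y, (p y == x) == (y == x)].

Lemma isolatedP p x :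
  reflect (p x = x /\ forall y, p y = x -> y = x) (isolated p x).
Proof.
apply: (iffP forallP) => [h|[px h] y].
  split; first by apply/eqP; rewrite (eqP (h x)).
  by move=> y /eqP; rewrite (eqP (h y)) => /eqP.
by apply/eqP; apply/eqP/eqP => [/h|->].
Qed.

(** Forests on [B] are extended to [T] by singleton trees, so that removing a vertex from [B] does
    not change the type. *)
Definition forests_on B I : {set {ffun T -> T}} :=
  [set p | [&& grounded p, [forall x in ~: B, isolated p x]
             & [forall x in I, ~~ isolated p x]]].

(** Once its root set is singled out, a forest on [B] falls under the count of [rooted_at]. *)
Lemma forests_on_layers B p :
  (p \in forests_on B set0) =
  (p \in rooted_at (B :\: [set x in B | p x == x]) [set x in B | p x == x]).
Proof.
rewrite inE; apply/and3P/rooted_atP => [[gp /forall_inP hB _]|[gp hA hn hf]].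
  (* An image outside [B] would be an isolated vertex with a child in [B]. *)
  have pB x : x \in B -> p x \in B.
    move=> xB; apply/negPn/negP => /[dup] pxB; rewrite -in_setC => /hB /isolatedP[_ h].
    by rewrite -(h x erefl) xB in pxB.
  split=> // x; rewrite !inE.
  - by move=> /andP[_ /pB ->]; rewrite /= andbT orNb.
  - by rewrite andbC; case: (x \in B).
  - case: (boolP (x \in B)) => [_|xB _]; first by rewrite andbT negbK => /eqP.
    by have /hB/isolatedP[] : x \in ~: B by rewrite inE.
split=> //; last by apply/forall_inP => x; rewrite inE.
apply/forall_inP => x; rewrite inE => xB.
have px : p x = x by apply: hf; rewrite !inE (negPf xB).
apply/isolatedP; split=> // y pyx; apply/eqP/negPn/negP => yx.
have pyy : p y != y by rewrite pyx eq_sym.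
have [yB|yB] := boolP (y \in B).
  by have := hA y; rewrite !inE (negPf pyy) yB pyx (negPf xB) => /(_ isT).
by move: pyy; rewrite hf ?eqxx // !inE (negPf yB).
Qed.

(** Summing over root sets gives [planted_count_rec] with r = 1, as if all roots were attached to
    one extra vertex. *)
Lemma card_forests_on0 B : #|forests_on B set0| = #|B|.+1 ^ #|B|.-1.
Proof.
rewrite -sum1_card.
rewrite (partition_big (fun p => [set x in B | p x == x]) (fun S => S \subset B)) /=; last first.
  by move=> p _; apply/subsetP => x; rewrite inE => /andP[].
transitivity (\sum_(S : {set T} | S \subset B) 1 ^ #|S| * planted_count (#|B| - #|S|) #|S|).
  apply: eq_bigr => S sSB; rewrite exp1n mul1n.
  have dS : [disjoint B :\: S & S] by rewrite -setI_eq0 setIDAC setDIl setDv setI0.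
  rewrite -[in X in planted_count X](setIidPr sSB) -cardsD -card_rooted_at //.
  rewrite sum1dep_card; apply: eq_card => p; rewrite in_set forests_on_layers.
  apply/andP/idP => [[+ /eqP <-] //|pBS].
  suff -> : [set x in B | p x == x] = S by [].
  case/rooted_atP: pBS => _ _ hn hf; apply/setP => x; rewrite inE.
  have [xS|xS] := boolP (x \in S); first by rewrite (subsetP sSB) // hf ?eqxx // inE xS.
  by apply/negP => /andP[xB]; apply/negP/hn; rewrite inE xS.
rewrite (sum_subsets_card B (fun s => 1 ^ s * planted_count (#|B| - s) s)).
case: #|B| => [|b]; first by rewrite big_ord1.
by rewrite planted_count_rec /= mul1n addn1.
Qed.

Lemma forests_on_isolated B I x : x \in B -> x \notin I ->
  [set p in forests_on B I | isolated p x] = forests_on (B :\ x) I.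
Proof.
move=> xB xI; apply/setP => p; rewrite !inE.
rewrite -andbA -andbA; congr (_ && _); rewrite andbC -andbA [RHS]andbC.
congr (_ && _); apply/andP/forall_inP => [[ix /forall_inP h] y|h].
  by rewrite !inE negb_and negbK => /orP[/eqP->//|yB]; apply: h; rewrite inE.
split; first by apply: h; rewrite !inE eqxx.
by apply/forall_inP => y; rewrite inE => yB; apply: h; rewrite !inE (negPf yB) andbF.
Qed.

(** Drop the condition on one [x] in [I], then subtract the forests where [x] is isolated, which
    live on [B :\ x]. Both counts have one condition fewer, at consecutive arguments: this is one
    difference. *)
Lemma card_forests_on B I : I \subset B ->
  (#|forests_on B I|%:R = fdiff #|I| (fun a => (a.+1 ^ a.-1)%:R) (#|B| - #|I|) :> rat)%R.
Proof.
have [n] := ubnP #|I|; elim: n B I => // n IHn B I In sIB.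
have [I0|[x xI]] := set_0Vmem I.
  by rewrite I0 card_forests_on0 cards0 subn0.
have xB := subsetP sIB x xI.
have := cardsD1 x I; rewrite xI add1n => cI.
have := cardsD1 x B; rewrite xB add1n => cB.
have sI : I :\ x \subset B :\ x by apply: setSD.
pose X := forests_on B (I :\ x); pose Y := [set p | isolated p x].
have XI : X :&: Y = forests_on (B :\ x) (I :\ x).
  rewrite -forests_on_isolated ?setD11 //; apply/setP => p.
  by rewrite in_setI ![in RHS]in_set [p \in Y]in_set [p \in X]in_set.
have XD : X :\: Y = forests_on B I.
  apply/setP => p; rewrite in_setD [p \in Y]in_set !in_set andbC -!andbA.
  do 2![congr (_ && _)]; apply/andP/forall_inP => [[/forall_inP h nx] y yI|h].
    by have [->//|yx] := eqVneq y x; apply: h; rewrite !inE yx.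
  split; last exact: h.
  by apply/forall_inP => y; rewrite !inE => /andP[_ /h].
have In' : #|I :\ x| < n by rewrite -ltnS -cI.
have := cardsID Y X; rewrite XI XD => e.
have -> : (#|forests_on B I|%:R = #|X|%:R - #|forests_on (B :\ x) (I :\ x)|%:R :> rat)%R.
  by rewrite -e natrD addrAC subrr add0r.
rewrite !IHn //; last by apply: subset_trans (subD1set _ _) sIB.
have := subset_leq_card sI => le.
by rewrite cI cB fdiffS subSS subSn.
Qed.
End Count.

(** * Labeled forests and parent functions *)

Lemma set2_eq (T : finType) (a b c d : T) :
  [set a; b] = [set c; d] -> a = c /\ b = d \/ a = d /\ b = c.
Proof.
move=> /setP e; have := e a; have := e b; have := e c; have := e d.
rewrite !inE !eqxx !orbT /= => hd hc /esym hb /esym ha.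
case/orP: ha => /eqP ?; case/orP: hb => /eqP ?; subst; auto.
- by case/orP: hd => /eqP ?; subst; auto.
- by case/orP: hc => /eqP ?; subst; auto.
Qed.

Local Arguments adj : simpl never.

(** * Parents in a rooted tree *)

Section Trees.
Variable T : finType.
Implicit Types (t : rooted_graph T) (x y z : T).

Lemma adj_sym t : symmetric (adj t).
Proof. by move=> x y; rewrite /adj /= setUC. Qed.

(** A repetition-free cycle always meets the length bound of the definition. *)
Lemma acyclicP t :
  reflect (forall c : seq T, (2 < size c)%N -> ~ ucycle (adj t) c) (acyclic_graph t).
Proof.
apply: (iffP forallP) => [h c c2 uc|h l].
  have cT : (size c < #|T|.+1)%N.
    by rewrite ltnS; case/andP: uc => _ /card_uniqP <-; apply: max_card.
  by have /forallP/(_ (in_tuple c))/implyP/(_ c2)/negP := h (Ordinal cT).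
by apply/forallP => c; apply/implyP => l2; apply/negP/h; rewrite size_tuple.
Qed.

Lemma simple_graphP t : simple_graph t -> forall x y, adj t x y ->
  [/\ x != y, x \in vertices t & y \in vertices t].
Proof.
move=> /forall_inP h x y /h; rewrite cards2 => /andP[xy /subsetP s].
by split; [case: (x == y) xy|apply: s|apply: s]; rewrite // !inE eqxx ?orbT.
Qed.

Definition adj_off t x : rel T := [rel a b | [&& adj t a b, a != x & b != x]].

(* [y] is the next vertex on the path from [x] to the root of [t]. *)
Definition parent t x y : bool := adj t x y && connect (adj_off t x) y (root_of t).

Lemma adj_off_sym t x : symmetric (adj_off t x).
Proof. by move=> a b; rewrite /adj_off /= adj_sym; congr (_ && _); apply: andbC. Qed.

Lemma connect_adj_off t x y s : path (adj t) y s -> x \notin y :: s ->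
  connect (adj_off t x) y (last y s).
Proof.
move=> p xs; apply/connectP; exists s => //.
elim: s y p xs => //= z s IHs y /andP[yz p]; rewrite !inE !negb_or => /and3P[xy xz xs].
by rewrite IHs ?inE ?negb_or ?xz // andbT /adj_off /= yz eq_sym xy eq_sym xz.
Qed.

Lemma path_adj_off t x y s : path (adj_off t x) y s -> y != x ->
  path (adj t) y s /\ x \notin y :: s.
Proof.
elim: s y => [|z s IHs] y /=; first by rewrite inE eq_sym.
move=> /andP[/and3P[yz yx zx] /IHs/(_ zx)[p xs]] _.
by rewrite yz p inE negb_or eq_sym yx xs.
Qed.

Section OneTree.
Variable t : rooted_graph T.
Hypothesis tT : rooted_tree t.

Let tS : simple_graph t. Proof. by case/and4P: tT. Qed.

Lemma tree_path x : x \in vertices t ->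
  exists s, [/\ path (adj t) x s, last x s = root_of t & uniq (x :: s)].
Proof.
case/and4P: tT => rt _ /forall_inP/(_ x) h _ /h/forall_inP/(_ _ rt)/connectP[s p ->].
by case: (shortenP p) => s' p' u _; exists s'.
Qed.

Lemma parent_exists x : x \in vertices t -> x != root_of t -> exists y, parent t x y.
Proof.
case/tree_path => -[|y s] /= []; first by move=> _ ->; rewrite eqxx.
move=> /andP[xy p] l /andP[xs u] _; exists y; rewrite /parent xy -l.
exact: connect_adj_off.
Qed.

Lemma parent_root y : ~~ parent t (root_of t) y.
Proof.
apply/andP => -[ry /connectP[s p l]]; have [nry _ _] := simple_graphP tS ry.
rewrite eq_sym in nry; case: (path_adj_off p nry) => _.
by rewrite l mem_last.
Qed.

(** Two distinct parents would be joined, through the root, by a simple path avoiding [x], which [x]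
    closes into a cycle. *)
Lemma parent_uniq x y z : parent t x y -> parent t x z -> y = z.
Proof.
move=> /andP[xy yr] /andP[xz zr]; apply/eqP/negPn/negP => yz.
have [nxy _ _] := simple_graphP tS xy.
rewrite eq_sym in nxy.
have : connect (adj_off t x) y z.
  by apply: connect_trans yr _; rewrite (sym_connect_sym (@adj_off_sym _ _)).
case/connectP => s p l; rewrite {}l in xz yz *.
case/shortenP: p xz yz => s' p u _ xz yz.
have [p' xs] := path_adj_off p nxy.
case/and4P: tT => _ _ _ /acyclicP/(_ [:: x, y & s']); apply.
  (* Distinct endpoints make [s'] nonempty, so the cycle has at least 3 vertices. *)
  by case: (s') yz => //=; rewrite eqxx.
by move: u; rewrite /ucycle /= rcons_path xy p' adj_sym xz xs.
Qed.

(** If a simple path from [x] to the root avoids [y], then [x] is the parent of [y]; otherwise its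
    part from [y] on avoids [x]. *)
Lemma edge_parent x y : adj t x y -> parent t x y || parent t y x.
Proof.
move=> xy; have [nxy xV yV] := simple_graphP tS xy.
have [s [p l u]] := tree_path xV.
have [yxs|yxs] := boolP (y \in x :: s); last first.
  by rewrite /parent [in X in _ || X]adj_sym xy -l connect_adj_off ?orbT.
move: yxs; rewrite inE eq_sym (negPf nxy) => /= ys.
case/splitPr: ys p l u => s1 s2; rewrite cat_path last_cat /= => /and3P[_ _ p] l.
rewrite mem_cat negb_or cat_uniq => /andP[/andP[_ xs] _].
by rewrite /parent xy -l connect_adj_off.
Qed.

End OneTree.
End Trees.

(** * The bijection between parent functions and labeled forests *)

Section Bijection.
Variable T : finType.
Implicit Types (p q : {ffun T -> T}) (r x y : T) (t : rooted_graph T).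

Definition tree_of p r : rooted_graph T :=
  ([set x | fconnect p x r],
   [set [set x; p x] | x in [set x | fconnect p x r & p x != x]], r).

Definition forest_of p : {set rooted_graph T} :=
  [set tree_of p r | r in [set r | p r == r]].

Lemma mem_forest_of p r : p r = r -> tree_of p r \in forest_of p.
Proof. by move=> pr; apply: imset_f; rewrite inE pr. Qed.

(** Testing [a] alone suffices, since a vertex and its parent reach the same root. *)
Lemma adj_tree_of p r a b : p r = r ->
  adj (tree_of p r) a b = [&& fconnect p a r, a != b & (p a == b) || (p b == a)].
Proof.
move=> pr; apply/imsetP/idP => [[x]|/and3P[ar ab /orP[]/eqP e]].
- rewrite inE => /andP[xr px] /set2_eq[[-> ->]|[-> ->]].
    by rewrite xr eq_sym px eqxx.
  by rewrite fconnect_fix_next // xr px eqxx orbT.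
- by exists a; rewrite ?inE ?e // ar eq_sym.
- exists b; last by rewrite e setUC.
  by rewrite inE -fconnect_fix_next // e ar ab.
Qed.

Lemma rooted_tree_of p r : grounded p -> p r = r -> rooted_tree (tree_of p r).
Proof.
move=> /groundedP[d dp] pr; apply/and4P; split.
- by rewrite inE connect0.
- apply/forall_inP => e /imsetP[x]; rewrite inE => /andP[xr px] ->.
  rewrite cards2 [x == _]eq_sym px /=; apply/subsetP => y /set2P[] ->; rewrite inE //.
  by rewrite fconnect_fix_next.
- have toroot x : fconnect p x r -> connect (adj (tree_of p r)) x r.
    move/iter_findex; move: (findex _ _ _) => n.
    elim: n x => [x /= ->|n IHn x]; first exact: connect0.
    move=> e; have xr : fconnect p x r by rewrite -e fconnect_iter.
    rewrite iterSr in e; have [px|px] := eqVneq (p x) x; first by rewrite px in e; apply: IHn.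
    apply: connect_trans (IHn _ e); apply: connect1.
    by rewrite adj_tree_of // xr eq_sym px eqxx.
  apply/forall_inP => x; rewrite inE => /toroot xr.
  apply/forall_inP => y; rewrite inE => /toroot.
  by rewrite (sym_connect_sym (@adj_sym _ _)); apply: connect_trans.
apply/acyclicP => c; case: c => // x0 c0; set c := x0 :: c0 => c2 uc.
have x0c : x0 \in c by rewrite mem_head.
(* A vertex of maximal rank on the cycle can only be joined to its own parent, yet it has two
   distinct neighbours there. *)
case: (arg_maxnP d x0c) => x xc xmax.
have px y : y \in c -> adj (tree_of p r) x y -> p x = y.
  move=> yc; rewrite adj_tree_of // => /and3P[_ xy /orP[]/eqP // e].
  have := dp y; rewrite e => /(_ xy); rewrite ltnNge => /negP[]; exact: xmax.
case: (rot_to xc) => i s e.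
have := uc; rewrite -(rot_ucycle i) e.
have := c2; rewrite -(size_rot i) e.
have sc y : y \in s -> y \in c by move=> ys; rewrite -(mem_rot i) e inE ys orbT.
case: s sc {e} => // y s sc /= s2.
rewrite /ucycle /= rcons_path => /and3P[/and3P[xy _ ly] _ /andP[ys _]].
have s0 : s != [::] by case: (s) s2.
have lys : last y s \in s by case: (s) s0 => //= z s' _; apply: mem_last.
rewrite adj_sym in ly.
move: ys; rewrite -(px y) ?(px (last y s)) ?lys //; apply: sc; rewrite ?mem_head //.
by rewrite inE lys orbT.
Qed.

Lemma labeled_forest_of p : grounded p -> labeled_forest (forest_of p).
Proof.
move=> gp; have disj r r' x : p r = r -> p r' = r' ->
  x \in vertices (tree_of p r) -> x \in vertices (tree_of p r') -> r = r'.
  by move=> pr pr'; rewrite !inE; apply: fconnect_fix_inj.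
have rV r : r \in vertices (tree_of p r) by rewrite inE connect0.
apply/and3P; split.
- apply/forall_inP => t /imsetP[r]; rewrite inE => /eqP pr ->.
  exact: rooted_tree_of.
- apply/dinjectiveP => t t' /imsetP[r]; rewrite inE => /eqP pr ->.
  case/imsetP=> r'; rewrite inE => /eqP pr' -> e; congr tree_of.
  by apply: (disj r r' r) => //; rewrite -e.
apply/and3P; split.
- apply/eqP/setP => x; rewrite [RHS]inE; apply/bigcupP.
  have /forallP/(_ x)/existsP[r /andP[/eqP pr xr]] := gp.
  by exists (vertices (tree_of p r)); rewrite ?inE //; apply/imset_f/mem_forest_of.
- apply/trivIsetP => A B /imsetP[t /imsetP[r]]; rewrite inE => /eqP pr -> ->.
  case/imsetP => t' /imsetP[r']; rewrite inE => /eqP pr' -> ->.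
  apply: contraNT => /pred0Pn[x /andP[xr xr']]; apply/eqP; congr (vertices (tree_of p _)).
  exact: disj xr xr'.
- by apply/imsetP => -[t /imsetP[r _ ->] e]; have := rV r; rewrite -e inE.
Qed.

(** The roots of the trees determine the fixed points; the other values are recovered from the edges
    by induction on the rank. *)
Lemma forest_of_inj : {in [set p | grounded p] &, injective forest_of}.
Proof.
move=> p q; rewrite !inE => gp gq e; apply/ffunP => x.
have same r : p r = r -> q r = r /\ tree_of p r = tree_of q r.
  move=> /mem_forest_of; rewrite e => /imsetP[r']; rewrite inE => /eqP qr' er.
  have rr' : r = r' := congr1 (@root_of _) er.
  by rewrite -rr' in qr' er.
have /groundedP[d dp] := gp.
have [n] := ubnP (d x); elim: n x => // n IHn x dx.
have [px|px] := eqVneq (p x) x; first by rewrite px (same x px).1.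
have /forallP/(_ x)/existsP[r /andP[/eqP pr xr]] := gp.
have [qr ept] := same r pr.
have : adj (tree_of p r) x (p x) by rewrite adj_tree_of // xr eq_sym px eqxx.
rewrite ept adj_tree_of // => /and3P[_ _ /orP[]/eqP // qpx].
(* If the edge came from [q (p x) = x], the induction hypothesis at [p x] would give [p] a
   2-cycle. *)
have ppx : p (p x) = x by rewrite IHn //; apply: leq_trans (dp x px) dx.
have := dp (p x); rewrite ppx eq_sym => /(_ px).
by rewrite ltnNge ltnW // dp.
Qed.

Lemma forest_of_surj F : labeled_forest F -> exists2 p, grounded p & F = forest_of p.
Proof.
case/and3P => /forall_inP tr /dinjectiveP inj /and3P[/eqP cov /trivIsetP triv _].
have ex x : exists2 t, t \in F & x \in vertices t.
  have : x \in cover (@vertices T @: F) by rewrite cov inE.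
  by case/bigcupP => A /imsetP[t tF ->] xt; exists t.
have un t t' x : t \in F -> t' \in F -> x \in vertices t -> x \in vertices t' -> t = t'.
  move=> tF tF' xt xt'; apply: inj => //; apply/eqP/negPn/negP => ne.
  have /pred0P/(_ x) := triv _ _ (imset_f _ tF) (imset_f _ tF') ne.
  by rewrite /= xt xt'.
have adjV t x y : t \in F -> adj t x y -> [/\ x != y, x \in vertices t & y \in vertices t].
  by move=> /tr/and4P[_ st _ _]; apply: simple_graphP.
(* The default value [x] serves the roots, which have no parent. *)
pose p := [ffun x => odflt x [pick y | [exists t in F, parent t x y]]].
have pparent t x y : t \in F -> parent t x y -> p x = y.
  move=> tF txy; rewrite ffunE; case: pickP => [z /exists_inP[t' tF' txz]|/(_ y)] /=.
    have [_ xt _] := adjV t x y tF (andP txy).1.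
    have [_ xt' _] := adjV t' x z tF' (andP txz).1.
    rewrite (un t' t x) // in txz; exact: (parent_uniq (tr t tF) txz txy).
  by move/negbT/exists_inP; case; exists t.
have proot t : t \in F -> p (root_of t) = root_of t.
  move=> tF; rewrite ffunE; case: pickP => //= z /exists_inP[t' tF' txz].
  have [_ xt' _] := adjV t' _ z tF' (andP txz).1.
  have rt : root_of t \in vertices t by case/and4P: (tr t tF).
  by rewrite (un t' t _ tF' tF xt' rt) in txz; have := parent_root (tr t tF) z; rewrite txz.
have toroot t x : t \in F -> x \in vertices t -> fconnect p x (root_of t).
  move=> tF /(tree_path (tr t tF))[s [pth l u]].
  elim: s x pth l u => [|y s IHs] x /=; first by move=> _ ->; rewrite connect0.
  move=> /andP[xy pth] l /andP[xs u].
  apply: connect_trans (IHs y pth l u); rewrite -(pparent t x y) ?fconnect1 //.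
  by rewrite /parent xy -l connect_adj_off.
exists p.
  apply/forallP => x; have [t tF xt] := ex x; apply/existsP; exists (root_of t).
  by rewrite proot // eqxx toroot.
have treeE t : t \in F -> tree_of p (root_of t) = t.
  move=> tF; have tV x : fconnect p x (root_of t) = (x \in vertices t).
    apply/idP/idP => [xr|]; last exact: toroot.
    (* The root of the tree [t'] of [x] is reachable too; the two fixed points agree, so [t] and
       [t'] share a vertex and coincide. *)
    have [t' tF' xt'] := ex x.
    have e := fconnect_fix_inj (proot t tF) (proot t' tF') xr (toroot t' x tF' xt').
    have rt : root_of t \in vertices t by case/and4P: (tr t tF).
    have rt' : root_of t' \in vertices t' by case/and4P: (tr t' tF').
    by rewrite (un t t' (root_of t)) // e.
  have VE : [set x | fconnect p x (root_of t)] = vertices t.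
    by apply/setP => x; rewrite inE tV.
  have EE : [set [set x; p x] | x in [set x | fconnect p x (root_of t) & p x != x]] = edges t.
    apply/setP => e; apply/imsetP/idP => [[x]|et].
      rewrite inE tV => /andP[xt px] ->.
      have [xr|xr] := eqVneq x (root_of t); first by rewrite xr proot ?eqxx in px.
      by have [y txy] := parent_exists (tr t tF) xt xr; rewrite (pparent t x y) //;
        case/andP: txy.
    have /and4P[_ /forall_inP/(_ e et) /andP[/cards2P[x [y [xy ee]]] _] _ _] := tr t tF.
    have txy : adj t x y by rewrite /adj /= -ee.
    have [_ xt yt] := adjV t x y tF txy.
    case/orP: (edge_parent (tr t tF) txy) => /(pparent t _ _ tF) pe.
      by exists x; rewrite ?inE ?tV ?xt pe // eq_sym.
    by exists y; rewrite ?inE ?tV ?yt pe // ee setUC.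
  by rewrite /tree_of VE EE; case: (t) => -[].
apply/setP => t; apply/idP/imsetP => [tF|[r]].
  by exists (root_of t); rewrite ?inE ?proot ?treeE.
rewrite inE => /eqP pr ->; have [t' tF' rt'] := ex r.
(* A fixed point that is not a root would be its own parent, hence the end of a loop. *)
suff -> : r = root_of t' by rewrite treeE.
apply/eqP/negPn/negP => nr.
have [y try] := parent_exists (tr t' tF') rt' nr.
by have [/negP[]] := adjV t' r y tF' (andP try).1; rewrite -(pparent t' r y) // pr.
Qed.

Lemma singleton_forest_of p x : singleton_tree (forest_of p) x = isolated p x.
Proof.
apply/exists_inP/isolatedP => [[t /imsetP[r]]|[px h]].
  rewrite inE => /eqP pr -> /eqP/setP e.
  have := e r; rewrite !inE connect0 => /esym/eqP rx; subst r; split=> // y pyx.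
  by have := e y; rewrite !inE -pyx fconnect1 => /esym/eqP.
exists (tree_of p x); first exact: mem_forest_of.
apply/eqP/setP => y; rewrite !inE; apply/idP/eqP => [/iter_findex|->]; last exact: connect0.
by move: (findex _ _ _) => n; elim: n => //= n IHn /h/IHn.
Qed.

End Bijection.

(** * The numbers [L] as differences, and the three identities *)

Lemma L_fdiff n k :
  ((L (n + k) k)%:R = fdiff n (fun a => (a.+1 ^ a.-1)%:R) k :> rat)%R.
Proof.
have kn : k < (n + k).+1 by rewrite ltnS leq_addl.
(* The vertex [v] carries the label k + 1. With n + k vertices in [B] and n in [I], the differences
   are taken at k. *)
pose v := Ordinal kn; pose B := [set~ v]; pose I := [set i : 'I_(n + k).+1 | v < i].
have cB : #|B| = n + k by rewrite cardsC1 card_ord.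
have cI : #|I| = n.
  rewrite -sum1dep_card -(big_mkord (fun i => k < i) (fun=> 1)).
  by rewrite -(big_nat_widenl k.+1 0 _ xpredT) // sum_nat_const_nat muln1 subSS addnK.
have sIB : I \subset B by apply/subsetP => i; rewrite !inE; apply: contraTneq => ->; rewrite ltnn.
have := card_forests_on sIB; rewrite cB cI addKn => <-; congr (_%:R)%R.
rewrite -(card_in_imset (f := @forest_of _)); last first.
  move=> p q; rewrite !inE => /andP[gp _] /andP[gq _].
  by apply: forest_of_inj; rewrite inE.
apply: eq_card => F; rewrite inE; apply/andP/imsetP.
  case=> /forest_of_surj[p gp ->] /existsP[w /and3P[/eqP wk sw /forall_inP h]].
  have wv : w = v by apply: val_inj.
  exists p => //; rewrite inE gp /=; apply/andP; split.
    by apply/forall_inP => x; rewrite setCK inE => /eqP->; rewrite -singleton_forest_of -wv.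
  by apply/forall_inP => i; rewrite inE -singleton_forest_of -wv; apply: h.
case=> p; rewrite inE => /and3P[gp /forall_inP hB /forall_inP hI] ->; split.
  exact: labeled_forest_of.
apply/existsP; exists v; rewrite eqxx singleton_forest_of hB ?setCK ?inE //=.
by apply/forall_inP => i vi; rewrite singleton_forest_of hI // inE.
Qed.

Local Open Scope ring_scope.

(** At a = 0 the truncated exponent gives 1 ^ 0, which agrees with 1 ^ (-1). *)
Lemma cayley_powerE a : cayley_power a = (a.+1 ^ a.-1)%:R.
Proof.
case: a => [|a]; first by rewrite /cayley_power exp1rz.
by rewrite /cayley_power intS addrAC subrr add0r -exprnP natrX.
Qed.

Theorem theorem5p1 (n m k : nat) :
  [/\ (L (n + k) k)%:R =
        \sum_(j < n.+1)
          (-1) ^+ (n - j) * 'C(n, j)%:R * cayley_power (k + j) :> rat,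
      L (n + m + k) (m + k) =
        (\sum_(j < m.+1) 'C(m, j) * L (n + k + j) k)%N
    & \sum_(j < n.+1)
        binom_poly (j%:R + 'X - 1) j * (L (n + m) (m + j))%:R =
      \sum_(j < n.+1)
        (-1) ^+ (n - j) * binom_poly (n%:R + 'X) j
          * (cayley_power (m + j))%:P].
Proof.
split.
- by rewrite L_fdiff fdiffE; apply: eq_bigr => j _; rewrite cayley_powerE.
- apply/eqP; rewrite -(eqr_nat rat) -addnA L_fdiff fdiff_shift natr_sum; apply/eqP.
  by apply: eq_bigr => j _; rewrite natrM addnAC L_fdiff.
under [RHS]eq_bigr => j _ do rewrite cayley_powerE.
(* The general identity is applied to a sequence of constant polynomials, with p = ['X]. *)
rewrite -(binom_poly_diff (fun a => ((a.+1 ^ a.-1)%:R)%:P)).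
apply: eq_bigr => j _; congr (_ * _).
have jn : (j <= n)%N by rewrite -ltnS.
(* This form shows [L (n + m) (m + j)] as a difference of order n - j at m + j. *)
have -> : (n + m = n - j + (m + j))%N by rewrite addnCA subnK // addnC.
by rewrite -polyC_natr L_fdiff (raddf_fdiff polyC).
Qed.
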